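(* Let $p : (0,1) \to [0,\infty)$ be a continuous probability density with finite log-moment, i.e. $\int_0^1 p(t)\log(1/t)\,dt < \infty$. Let $(p_n)_{n\ge1}$ be a sequence of probability mass functions, $p_n$ supported on $[n]$, that strongly discretizes $p$. Let $d, k \ge 1$ be integers and let $(a_n)_{n \ge 1} \subset \mathbb{R}^d$ satisfy $$a_{n+1} = \sum_{j=1}^n p_n(j)\, a_j \quad \text{for all } n \ge k.$$ Then the sequence $(a_n)_{n\ge 1}$ converges.
   Context: $[n] = \{1,\dots,n\}$; a probability mass function $p_n$ supported on $[n]$ is extended by $p_n(j) = 0$ for integers $j \notin [n]$. Definition (strong discretization). Let $p:(0,1)\to[0,\infty)$ be a continuous probability density and $(p_n)_{n\ge1}$ a sequence of probability mass functions with $p_n$ supported on $[n]$. For real $x \ge 1$ define the probability density $p_x$ on $(0,1)$ by $p_x(t) = x\, p_{\lfloor x \rfloor}(\lceil t x\rceil)$ for $t \in (0,1)$. The sequence $(p_n)$ strongly discretizes $p$ if there exist constants $\kappa > 0$ and $C > 0$ such that $\|p_x - p\|_{1} = \int_0^1 |p_x(t) - p(t)|\,dt \le C x^{-\kappa}$ for all real $x \ge C$. *)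

(* Defs.v *)
From HB Require Import structures.
From mathcomp Require Import all_boot all_order all_algebra.
From mathcomp Require Import all_classical all_reals all_analysis.

Set Implicit Arguments.
Unset Strict Implicit.
Unset Printing Implicit Defensive.

Import Order.TTheory GRing.Theory Num.Theory.
Import numFieldNormedType.Exports.

Local Open Scope classical_set_scope.
Local Open Scope ring_scope.

(* A continuous probability density on (0, 1); the values of p outside the
   open unit interval are irrelevant junk. *)
Definition continuous_density (R : realType) (p : R -> R) : Prop :=
  [/\ {within `]0, 1[, continuous p},
      forall t : R, 0 < t < 1 -> 0 <= p t
    & (\int[lebesgue_measure]_(t in `]0%R, 1%R[) (p t)%:E = 1)%E].

Definition finite_log_moment (R : realType) (p : R -> R) : Prop :=
  (\int[lebesgue_measure]_(t in `]0%R, 1%R[) (p t * ln (1 / t))%:E < +oo)%E.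

(* q is a probability mass function supported on [n] = {1, ..., n}, extended
   by 0 to the other naturals. *)
Definition pmf_on (R : realType) (n : nat) (q : nat -> R) : Prop :=
  [/\ forall j : nat, 0 <= q j,
      forall j : nat, ~~ (1 <= j <= n)%N -> q j = 0
    & \sum_(1 <= j < n.+1) q j = 1].

(* For x >= 1 and 0 < t < 1, floor x and ceil (t * x) are positive integers, so
   taking absolute values only converts them from int to nat. *)
Definition step_density (R : realType) (pn : nat -> nat -> R) (x t : R) : R :=
  x * pn `|Num.floor x|%N `|Num.ceil (t * x)|%N.

Definition strongly_discretizes (R : realType) (pn : nat -> nat -> R)
    (p : R -> R) : Prop :=
  exists kappa C : R, [/\ 0 < kappa, 0 < C &
    forall x : R, 1 <= x -> C <= x ->
      (\int[lebesgue_measure]_(t in `]0%R, 1%R[)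
         `|step_density pn x t - p t|%:E <= (C * x `^ (- kappa))%:E)%E].

(* Main.v *)
Require Import Defs.
From HB Require Import structures.
From mathcomp Require Import all_boot all_order all_algebra.
From mathcomp Require Import all_classical all_reals all_analysis.
From mathcomp Require Import measurable_realfun ring lra.

Set Implicit Arguments.
Unset Strict Implicit.
Unset Printing Implicit Defensive.

Import Order.TTheory GRing.Theory Num.Theory.
Import numFieldNormedType.Exports.

Local Open Scope classical_set_scope.
Local Open Scope ring_scope.

(** It is enough to treat one coordinate, and since every late term is a convex
    combination of earlier ones, the sequence is bounded; adding a constant
    puts it in [0, M].

    The step function [A x] equal to [a n.+1] on [n, n + 1[ turns the recurrence
    into a multiplicative renewal equation: averaging [A (t * x)] against the
    step density at [x] gives [A x] exactly ([step_density_average]), so strong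
    discretization gives, with [q] the density extended by zero,

      [A x] = integral of [A (t * x) * q t] over [t], up to [D * x `^ (- kappa)]

    ([interpolation_renewal_solution]). Such an [A] converges
    ([renewal_solution_cvg]), by the following form of the renewal theorem.

    Near-maximal values spread. Dilation is continuous in L1, so [A] varies
    slowly on the logarithmic scale ([renewal_slow]). Let [L] be the limsup of
    [A]. An average close to [L] of values that are at most slightly above [L]
    forces [A (t * x)] to be close to [L] for all [t] in an interval where [q] is
    bounded below ([renewal_step]). Iterating, [A] is close to [L] on a stretch
    from [w * x] to [v * x] with [v / w] as large as desired ([carries_wide]).

    A conserved quantity compares limsup and liminf. The potential

      [K x] = integral over [t] of [q t] times the integral of [A z / z] over
      the interval from [t * x] to [x]

    is bounded thanks to the log-moment [m] of [q]. By Tonelli and dilation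
    invariance of [dz / z], its variation between [x] and [x'] is the integral
    over [x, x'] of the error of the renewal equation divided by [y]
    ([renewal_potential_balance]), and this error is integrable against [dy / y]
    because [kappa > 0]. At the end of a long stretch where [A] is close to [L],
    the potential is at least almost [L * m]; so it stays so
    ([renewal_potential_limsup]). The same holds for [M - A], whose limsup is [L']
    and whose potential is [M * m - K x]. Hence [L + L' <= M], that is, the limsup
    of [A] is at most its liminf. *)

(** * Integrals of nonnegative functions on the line *)

Section NonnegativeIntegrals.
Context {R : realType}.
Implicit Types (f g : R -> R).

(** Real integrands with extended-real values: for nonnegative [f] no
    integrability has to be known in advance. *)
Definition lint f : \bar R := (\int[@lebesgue_measure R]_t (f t)%:E)%E.

Lemma lint_ge0 f : (forall t, 0 <= f t) -> (0 <= lint f)%E.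
Proof. by move=> f0; apply: integral_ge0 => t _; rewrite lee_fin. Qed.

Lemma le_lint f g : measurable_fun setT f -> measurable_fun setT g ->
  (forall t, 0 <= f t <= g t) -> (lint f <= lint g)%E.
Proof.
move=> mf mg fg; apply: ge0_le_integral => //.
- by move=> t _; rewrite lee_fin; case/andP: (fg t).
- exact/measurable_EFinP.
- exact/measurable_EFinP.
- by move=> t _; rewrite lee_fin; case/andP: (fg t).
Qed.

Lemma lintD f g : measurable_fun setT f -> measurable_fun setT g ->
  (forall t, 0 <= f t) -> (forall t, 0 <= g t) ->
  lint (fun t => f t + g t) = (lint f + lint g)%E.
Proof.
move=> mf mg f0 g0; rewrite /lint.
under eq_integral do rewrite EFinD.
rewrite ge0_integralD//.
- by move=> t _; rewrite lee_fin.
- exact/measurable_EFinP.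
- by move=> t _; rewrite lee_fin.
- exact/measurable_EFinP.
Qed.

Lemma lintZ f (c : R) : measurable_fun setT f -> (forall t, 0 <= f t) ->
  0 <= c -> lint (fun t => c * f t) = (c%:E * lint f)%E.
Proof.
move=> mf f0 c0; rewrite /lint.
under eq_integral do rewrite EFinM.
rewrite ge0_integralZl_EFin//.
- by move=> t _; rewrite lee_fin.
- exact/measurable_EFinP.
Qed.

Lemma eq_lint f g : f =1 g -> lint f = lint g.
Proof. by move=> fg; apply: eq_integral => t _; rewrite fg. Qed.

Lemma measurable_guard d (T : measurableType d) (b : T -> bool) (f : T -> R) :
  measurable_fun setT b -> measurable_fun setT f ->
  measurable_fun setT (fun x => if b x then f x else 0).
Proof. by move=> mb mf; apply: measurable_fun_ifT. Qed.

Lemma lint_itv (a b : R) : a <= b ->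
  lint (fun t => if (a < t) && (t <= b) then 1 else 0) = (b - a)%:E.
Proof.
move=> ab; transitivity (@lebesgue_measure R `]a, b]%classic).
  rewrite -[X in lebesgue_measure X]setIT -integral_indic//.
  apply: eq_integral => t _; rewrite indicE.
  case: ifPn => abt; first by rewrite mem_set//= in_itv.
  by rewrite memNset//= in_itv/=; exact/negP.
rewrite lebesgue_measure_itv/= lte_fin EFinB.
by case: ltP => // ba; rewrite -EFinB; congr EFin; lra.
Qed.

(** The image of Lebesgue measure under the dilation, rescaled by [c], agrees
    with Lebesgue measure on half-open intervals, hence everywhere. *)
Lemma lint_dilation (c : R) f : 0 < c -> measurable_fun setT f ->
  (forall t, 0 <= f t) -> lint (fun t => c * f (c * t)) = lint f.
Proof.
move=> c0 mf f0; have mc : measurable_fun [set: R] ( *%R c) by [].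
pose nu' := pushforward (@lebesgue_measure R)
  ( *%R c : _ -> measurableTypeR R) : {measure set (measurableTypeR R) -> \bar R}.
pose nu := nu' mc.
pose nuc : {measure set (measurableTypeR R) -> \bar R} :=
  mscale (NngNum (ltW c0)) nu.
have nucE : forall A, measurable A -> lebesgue_measure A = nuc A.
  apply: lebesgue_measure_unique => _ [[a b]] _ <-.
  have -> : nuc `]a, b]%classic =
      (c%:E * @lebesgue_measure R ( *%R c @^-1` `]a, b]%classic))%E by [].
  rewrite (_ : _ @^-1` _ = `]a / c, b / c]%classic); last first.
    apply/seteqP; split=> t /=; rewrite !in_itv/= ltr_pdivrMr// ler_pdivlMr//;
      by rewrite mulrC.
  rewrite !lebesgue_measure_itv/= !lte_fin ltr_pM2r ?invr_gt0//.
  case: ifP => _; last by rewrite mule0.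
  by rewrite -!EFinB -EFinM; congr EFin; field; lra.
rewrite [RHS]/lint [RHS](@eq_measure_integral _ _ _ _ nuc); last first.
  by move=> A mA _; exact: nucE.
rewrite ge0_integral_mscale//=; last 2 first.
- exact/measurable_EFinP.
- by move=> t _; rewrite lee_fin.
rewrite ge0_integral_pushforward//=; last 2 first.
- exact/measurable_EFinP.
- by move=> t _; rewrite lee_fin.
rewrite preimage_setT -[RHS]lintZ//; last exact: ltW.
exact: (measurableT_comp mf).
Qed.

End NonnegativeIntegrals.

(** * Densities with a finite log-moment *)

Section LogDensities.
Context {R : realType}.
Implicit Types (f q : R -> R).

Lemma lint_dominated_cvg0 (F : nat -> R -> R) (g : R -> R) (eps : R) :
  (forall n, measurable_fun setT (F n)) -> measurable_fun setT g ->
  (forall n t, 0 <= F n t <= g t) -> (lint g < +oo)%E ->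
  (forall t, F n t @[n --> \oo] --> 0) -> 0 < eps ->
  exists n, (lint (F n) <= eps%:E)%E.
Proof.
move=> mF mg Fg goo F0 eps0.
have g0 t : 0 <= g t by case/andP: (Fg 0%N t); exact: le_trans.
have ig : (@lebesgue_measure R).-integrable setT (EFin \o g).
  apply/integrableP; split; first exact/measurable_EFinP.
  rewrite (_ : (\int[_]_(x in _) _)%E = lint g)//.
  by apply: eq_integral => t _; rewrite /= ger0_norm.
have [||||_ _] := @dominated_convergence _ _ _ (@lebesgue_measure R) setT
  measurableT (fun n t => (F n t)%:E) (fun=> 0%E) (EFin \o g) _ _ _ ig.
- by move=> n; exact: (measurableT_comp _ (mF n)).
- by [].
- apply: aeW => t _; apply: cvg_EFin; last exact: F0.
  exact: nearW.
- apply: aeW => t n _ /=; rewrite lee_fin ger0_norm; by case/andP: (Fg n t).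
rewrite integral0 => /fine_cvgP[Fin]/(@cvgr_lt R nat)/(_ _ eps0) lteps.
near \oo => n; exists n.
have Fn : lint (F n) \is a fin_num by near: n.
rewrite -(fineK Fn) lee_fin ltW//.
by near: n.
Unshelve. all: by end_near. Qed.

Lemma lint_near0_small f (eps : R) : measurable_fun setT f ->
  (forall t, 0 <= f t) -> (forall t, t <= 0 -> f t = 0) ->
  (lint f < +oo)%E -> 0 < eps ->
  exists2 th : R, 0 < th < 1 &
    (lint (fun t => if t < th then f t else 0)%R <= eps%:E)%E.
Proof.
move=> mf f0 fneg foo eps0.
have [|||n ltn] := @lint_dominated_cvg0
  (fun n t => if t < n.+2%:R^-1 then f t else 0) f eps _ mf _ foo _ eps0.
- move=> n; apply: measurable_guard => //.
  exact: measurable_fun_ltr.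
- by move=> n t; case: ifP => _; rewrite f0 lexx.
- move=> t; have [t0|t0] := leP t 0.
    rewrite (_ : (fun _ => _) = (fun=> 0)); first exact: cvg_cst.
    by apply/funext => n; rewrite fneg// if_same.
  apply: cvg_near_cst; near=> n.
  rewrite ifF//; apply/negbTE; rewrite -leNgt.
  have : n.+1%:R^-1 < t by near: n; exact: (near_infty_natSinv_lt (PosNum t0)).
  by move=> /ltW; apply: le_trans; rewrite lef_pV2 ?posrE ?ltr0n// ler_nat.
exists n.+2%:R^-1 => //.
by rewrite invr_gt0 ltr0n/= invf_lt1// ltr1n.
Unshelve. all: by end_near. Qed.

(** A continuous probability density on (0, 1) with finite log-moment,
    extended by zero so that all integrals run over the whole line. *)
Record log_density q : Prop := LogDensity {
  log_density_measurable : measurable_fun setT q;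
  log_density_ge0 : forall t, 0 <= q t;
  log_density_out : forall t, ~~ (0 < t < 1) -> q t = 0;
  log_density_continuous : forall t, 0 < t < 1 -> {for t, continuous q};
  log_density_mass : lint q = 1%E;
  log_density_moment : (lint (fun t => q t * ln t^-1)%R < +oo)%E }.

(** The positive part of the difference is dominated by [q] itself, so dominated
    convergence applies although the dilated densities may have no common
    integrable bound. *)
Lemma log_density_dilation q (eps : R) : log_density q -> 0 < eps ->
  exists2 r : R, 0 < r & forall rho : R, 0 < rho -> 1 - r <= rho <= 1 ->
    (lint (fun t => Num.max 0 (q t - rho^-1 * q (rho^-1 * t)))%R <= eps%:E)%E.
Proof.
move=> [mq q0 qout qc q1 _] eps0; apply: contrapT => nex.
have /choice[rho rhoP] : forall n : nat, exists rho : R,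
    [/\ 0 < rho, 1 - n.+1%:R^-1 <= rho <= 1 &
    ~ (lint (fun t => Num.max 0 (q t - rho^-1 * q (rho^-1 * t)))%R
        <= eps%:E)%E].
  move=> n; apply: contrapT => nrho; apply: nex.
  exists n.+1%:R^-1; first by rewrite invr_gt0.
  move=> rho rho0 rho1; apply: contrapT => H; apply: nrho; exists rho.
  by split.
have rho_cvg : rho n @[n --> \oo] --> (1 : R).
  apply: (@squeeze_cvgr _ _ _ _ (fun n : nat => 1 - n.+1%:R^-1) (fun=> 1)).
  - by apply: nearW => n; case: (rhoP n).
  - rewrite -[X in _ --> X]subr0; apply: cvgB; first exact: cvg_cst.
    exact: (@cvg_harmonic R).
  - exact: cvg_cst.
have rhoV_cvg : (rho n)^-1 @[n --> \oo] --> (1 : R).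
  by rewrite -[X in _ --> X]invr1; apply: cvgV.
have [||||n] := @lint_dominated_cvg0
  (fun n t => Num.max 0 (q t - (rho n)^-1 * q ((rho n)^-1 * t)))
   q eps _ mq _ _ _ eps0.
- move=> n; apply: measurable_maxr => //.
  apply: measurable_funB => //; apply: measurable_funM => //.
  by apply: (measurableT_comp mq).
- move=> n t; rewrite le_max lexx/= ge_max q0/=.
  have [rn _ _] := rhoP n.
  by rewrite gerBl mulr_ge0// invr_ge0 ltW.
- by rewrite q1 ltry.
- move=> t; have [t01|/qout qt] := boolP (0 < t < 1); last first.
    rewrite (_ : (fun _ => _) = (fun=> 0)); first exact: cvg_cst.
    apply/funext => n; rewrite qt sub0r; apply/max_idPl.
    by rewrite oppr_le0 mulr_ge0// invr_ge0 ltW//; case: (rhoP n).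
  apply: (@squeeze_cvgr _ _ _ _ (fun=> 0)
     (fun n => `|q t - (rho n)^-1 * q ((rho n)^-1 * t)|)).
  + by apply: nearW => n; rewrite le_max lexx/= ge_max normr_ge0 ler_norm.
  + exact: cvg_cst.
  + rewrite -[X in _ --> X](@normr0 _ R); apply: cvg_norm.
    rewrite -(subrr (q t)); apply: cvgB; first exact: cvg_cst.
    rewrite -[X in _ --> X]mul1r; apply: cvgM => //.
    have : (rho n)^-1 * t @[n --> \oo] --> t.
      by rewrite -[X in _ --> X]mul1r; apply: cvgM => //; exact: cvg_cst.
    by move/cvg_comp; apply; exact: qc.
by case: (rhoP n).
Unshelve. all: by end_near. Qed.

End LogDensities.

(** * Approximate solutions of the renewal equation *)

Section RenewalSolutions.
Context {R : realType}.
Variables (q : R -> R) (qd : log_density q).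
Implicit Types (A : R -> R).

Let mq := log_density_measurable qd.
Let q0 := log_density_ge0 qd.
Let qout := log_density_out qd.

(** The average at scale [x]; [fine] loses nothing for bounded [A], see
    [rmeanE]. *)
Definition rmean A (x : R) : R := fine (lint (fun t => A (t * x) * q t)).

Record renewal_solution A (M D kappa X0 : R) : Prop := RenewalSolution {
  renewal_measurable : measurable_fun setT A;
  renewal_bounded : forall x, 0 <= A x <= M;
  renewal_rate : 0 < kappa;
  renewal_start : 0 < X0;
  renewal_error : forall x, X0 <= x -> `|A x - rmean A x| <= D * x `^ (- kappa) }.

Lemma powRN_small (D kappa eps : R) : 0 < kappa -> 0 < eps ->
  exists2 X : R, 0 < X & forall x, X <= x -> D * x `^ (- kappa) <= eps.
Proof.
move=> k0 eps0; pose m := Num.max (D / eps) 1.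
have m0 : 0 < m by rewrite lt_max ltr01 orbT.
exists (m `^ kappa^-1); first exact: powR_gt0.
move=> x Xx; have x0 : 0 < x by rewrite (lt_le_trans _ Xx)// powR_gt0.
have mx : m <= x `^ kappa.
  have <- : (m `^ kappa^-1) `^ kappa = m.
    by rewrite -powRrM mulVf ?gt_eqF// powRr1// ltW.
  by apply: ge0_ler_powR => //; rewrite ?nnegrE ?powR_ge0 ?(ltW k0) ?(ltW x0).
rewrite powRN ler_pdivrMr ?powR_gt0//.
have : D / eps <= x `^ kappa by rewrite (le_trans _ mx)// le_max lexx.
by rewrite ler_pdivrMr// mulrC.
Qed.

Lemma measurable_dilation A (x : R) : measurable_fun setT A ->
  measurable_fun setT (fun t : R => A (t * x)).
Proof.
move=> mA; have mx : measurable_fun setT (fun t : R => t * x).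
  exact: mulrr_measurable.
exact: (measurableT_comp mA mx).
Qed.

Lemma measurable_mean_integrand A (x : R) : measurable_fun setT A ->
  measurable_fun setT (fun t : R => A (t * x) * q t).
Proof. by move=> mA; apply: measurable_funM => //; exact: measurable_dilation. Qed.

Lemma rmeanE A (M x : R) : measurable_fun setT A ->
  (forall x, 0 <= A x <= M) ->
  (rmean A x)%:E = lint (fun t => A (t * x) * q t).
Proof.
move=> mA AM; rewrite /rmean fineK//.
have M0 : 0 <= M by case/andP: (AM 0); exact: le_trans.
rewrite ge0_fin_numE; last first.
  by apply: lint_ge0 => t; rewrite mulr_ge0//; case/andP: (AM (t * x)).
apply: (@le_lt_trans _ _ (lint (fun t => M * q t))).
  apply: le_lint; [exact: measurable_mean_integrand|exact: measurable_funM|].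
  move=> t; case/andP: (AM (t * x)) => A0 A1.
  by rewrite mulr_ge0//= ler_wpM2r.
by rewrite lintZ// (log_density_mass qd) mule1 ltry.
Qed.

(** The average is continuous under dilation because dilating the argument
    amounts to dilating the density. *)
Lemma renewal_slow A M D kappa X0 (eta : R) :
  renewal_solution A M D kappa X0 -> 0 < eta ->
  exists r X : R, [/\ 0 < r, 0 < X &
    forall y y', X <= y -> y <= y' <= (1 + r) * y -> A y' <= A y + eta].
Proof.
move=> [mA AM k0 X00 Aerr] eta0.
have M0 : 0 <= M by case/andP: (AM 0); exact: le_trans.
have eta30 : 0 < eta / 3 by lra.
have [X X_gt0 XP] := powRN_small D k0 eta30.
have epsM : 0 < eta / 3 / (M + 1) by rewrite divr_gt0//; lra.
have [r r0 rP] := log_density_dilation qd epsM.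
exists r, (Num.max X X0); split => //; first by rewrite lt_max X_gt0.
move=> y y'; rewrite ge_max => /andP[Xy X0y] /andP[yy' y'r].
have y0 : 0 < y by lra.
have y'0 : 0 < y' by lra.
pose rho := y / y'; have rho0 : 0 < rho by rewrite divr_gt0.
have rho1 : 1 - r <= rho <= 1.
  rewrite /rho ler_pdivlMr// ler_pdivrMr// mul1r yy' andbT.
  by nra.
have rhoy : rho^-1 * y = y' by rewrite /rho; field; lra.
have meany : lint (fun t => A (t * y) * q t) =
    lint (fun t => A (t * y') * (rho^-1 * q (rho^-1 * t))).
  rewrite -(@lint_dilation _ rho^-1)//.
  - apply: eq_lint => t; rewrite -mulrA mulrCA; congr (_ * _).
    by congr (A _); rewrite -rhoy; ring.
  - by rewrite invr_gt0.
  - exact: measurable_mean_integrand.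
  - by move=> t; rewrite mulr_ge0//; case/andP: (AM (t * y)).
have mqr : measurable_fun setT (fun t : R => rho^-1 * q (rho^-1 * t)).
  by apply: measurable_funM => //; apply: (measurableT_comp mq).
have qr0 t : 0 <= rho^-1 * q (rho^-1 * t).
  by rewrite mulr_ge0// invr_ge0 ltW.
pose dq t := Num.max 0 (q t - rho^-1 * q (rho^-1 * t)).
have mdq : measurable_fun setT dq.
  by apply: measurable_maxr => //; exact: measurable_funB.
have dq0 t : 0 <= dq t by rewrite le_max lexx.
have mean_le : rmean A y' <= rmean A y + eta / 3.
  rewrite -lee_fin EFinD (rmeanE _ mA AM) (rmeanE _ mA AM) meany.
  apply: (@le_trans _ _ (lint (fun t =>
      A (t * y') * (rho^-1 * q (rho^-1 * t)) + M * dq t))).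
    apply: le_lint.
    - exact: measurable_mean_integrand.
    - apply: measurable_funD; apply: measurable_funM => //.
      exact: measurable_dilation.
    - move=> t; case/andP: (AM (t * y')) => A0 A1; rewrite mulr_ge0//=.
      have : q t - rho^-1 * q (rho^-1 * t) <= dq t by rewrite le_max lexx orbT.
      by have := dq0 t; move: (dq t) (rho^-1 * _) => u v; nra.
  rewrite lintD//; last 4 first.
  - apply: measurable_funM => //; exact: measurable_dilation.
  - exact: measurable_funM.
  - by move=> t; rewrite mulr_ge0//; case/andP: (AM (t * y')).
  - by move=> t; rewrite mulr_ge0.
  rewrite lintZ// leeD2l//.
  apply: (@le_trans _ _ (M%:E * (eta / 3 / (M + 1))%:E)%E).
    by apply: lee_wpmul2l; rewrite ?lee_fin//; exact: rP.
  rewrite -EFinM lee_fin mulrA ler_pdivrMr; last lra.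
  by nra.
have := Aerr y X0y; have := Aerr y' (le_trans X0y yy').
have := XP y Xy; have := XP y' (le_trans Xy yy').
rewrite !ler_norml => ? ? /andP[_ ?] /andP[? _]; lra.
Qed.

Lemma log_density_pos : exists a b c : R,
  [/\ 0 < a, a < b, b < 1, 0 < c & forall t, a <= t <= b -> c <= q t].
Proof.
have [t t01 qt] : exists2 t, 0 < t < 1 & 0 < q t.
  apply: contrapT => nq; have := log_density_mass qd.
  rewrite (_ : lint q = 0%E); first by move=> /eqP; rewrite eqe eq_sym oner_eq0.
  rewrite -(integral0 lebesgue_measure setT); apply: eq_integral => t _.
  congr EFin; have [t01|/qout//] := boolP (0 < t < 1).
  apply/eqP; rewrite eq_le q0 andbT leNgt; apply/negP => qt; apply: nq.
  by exists t.
have qt2 : q t / 2 < q t by lra.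
have : \forall s \near t, q t / 2 < q s.
  exact: (cvgr_gt (q t) (log_density_continuous qd t01)).
move=> /nbhs_ballP[e /= e0 He].
pose b := Num.min (t + e / 2) ((t + 1) / 2).
exists t, b, (q t / 2); case/andP: t01 => t0 t1.
have bP : t < b /\ b <= t + e/2 /\ b < 1.
  by rewrite /b lt_min ge_min gt_min lexx/=; split; [lra|split => //; lra].
split; [by []|lra|lra|lra|].
move=> s /andP[ts sb]; apply/ltW/He; rewrite /ball/= ltr_norml; lra.
Qed.

(** If [A x] is almost [L], no [A y] with [y / x] well inside an interval where [q]
    is bounded below can be far below [L]: slow variation would extend the
    deficit to an interval and lower the average at [x] by a fixed amount, which
    the values above [L] are too small to compensate. *)
Lemma renewal_step A M D kappa X0 (L : R) :
  renewal_solution A M D kappa X0 ->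
  (forall delta, 0 < delta -> exists X, forall x, X <= x -> A x <= L + delta) ->
  exists al be : R, [/\ 0 < al, al < be, be < 1 & forall eta, 0 < eta ->
    exists delta X : R, [/\ 0 < delta, 0 < X &
      forall x, X <= x -> L - delta <= A x ->
      forall y, al * x <= y <= be * x -> L - eta <= A y]].
Proof.
move=> Asol AL; have [mA AM k0 X00 Aerr] := Asol.
have M0 : 0 <= M by case/andP: (AM 0); exact: le_trans.
have [a [b [c [a0 ab b1 c0 qc]]]] := log_density_pos.
exists a, ((a + b) / 2); split; [by []|lra|lra|move=> eta eta0].
have eta20 : 0 < eta / 2 by lra.
have [r [Xs [r0 Xs0 slow]]] := renewal_slow Asol eta20.
pose r' := Num.min r ((b - a) / 2).
have [r'0 r'r r'ab] : [/\ 0 < r', r' <= r & r' <= (b - a) / 2].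
  by rewrite /r' lt_min !ge_min !lexx orbT; split=> //; lra.
pose g := eta / 2 * c * (a * r').
have g0 : 0 < g by rewrite !mulr_gt0.
have g80 : 0 < g / 8 by lra.
have epsM : 0 < g / 8 / (M + 1) by rewrite divr_gt0//; lra.
have [th th01 tail] : exists2 th : R, 0 < th < 1 &
    (lint (fun t => if t < th then q t else 0)%R <= (g / 8 / (M + 1))%:E)%E.
  apply: lint_near0_small => //; last by rewrite (log_density_mass qd) ltry.
  by move=> t t0; apply: qout; rewrite ltNge t0.
case/andP: th01 => th0 th1.
have [Xe Xe0 eP] := powRN_small D k0 g80.
have [N NP] := AL _ g80.
have Lg : 0 <= L + g / 8.
  by rewrite (le_trans _ (NP N (lexx _)))//; case/andP: (AM N).
(* Four errors of size [g / 8] enter below: [delta], the excess of [A] over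
   [L], the mass of [q] below [th], and the error of the equation at [x]. *)
exists (g / 8), (Num.max (Num.max Xe X0) (Num.max (Xs / a) (N / th))).
split=> //; first by rewrite !lt_max Xe0.
move=> x; rewrite !ge_max => /andP[/andP[Xex X0x] /andP[Xsx Nx]] Ax y.
move=> /andP[axy yx]; rewrite leNgt; apply/negP => Ay.
have x0 : 0 < x by lra.
have Xsy : Xs <= y.
  by rewrite (le_trans _ axy)// mulrC -ler_pdivrMr.
have y0 : 0 < y by lra.
pose s := y / x.
have as_ : a <= s by rewrite /s ler_pdivlMr.
have sb : s <= (a + b) / 2 by rewrite /s ler_pdivrMr.
have s0 : 0 < s by lra.
(* The value at [y] lies below [L - eta], hence so do the values on the whole
   interval [y, (1 + r') * y], which costs the average at least [g]. *)
pose J t := (s < t) && (t <= s * (1 + r')).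
have Jlow t : J t -> A (t * x) <= L - eta / 2.
  move=> /andP[st tr].
  have : A (t * x) <= A y + eta / 2.
    apply: slow => //; apply/andP; split.
      by rewrite -ler_pdivrMr// ltW.
    rewrite -ler_pdivlMr// -mulrA -/s mulrC (le_trans tr)//.
    by rewrite ler_wpM2l ?(ltW s0)//; lra.
  lra.
have Jq t : J t -> c <= q t.
  move=> /andP[st tr]; apply: qc; apply/andP; split; first lra.
  rewrite (le_trans tr)//.
  have : s * r' <= 1 * r' by rewrite ler_pM2r//; lra.
  lra.
have mJ : measurable_fun setT (fun t : R => if J t then 1 else 0 : R).
  apply: measurable_guard => //; apply: measurable_and.
    exact: measurable_fun_ltr.
  exact: measurable_fun_ler.
have mtail : measurable_fun setT (fun t : R => if t < th then q t else 0).
  by apply: measurable_guard => //; exact: measurable_fun_ltr.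
have tail0 t : 0 <= (if t < th then q t else 0) by case: ifP.
have J0 t : 0 <= (if J t then 1 else 0 : R) by case: ifP.
have ec0 : 0 <= eta / 2 * c by rewrite mulr_ge0// ltW.
have Ar0 t : 0 <= A (t * x) * q t.
  by rewrite mulr_ge0//; case/andP: (AM (t * x)).
have key : rmean A x + eta / 2 * c * (s * r') <= L + g / 8 + g / 8.
  rewrite -lee_fin EFinD (rmeanE _ mA AM) EFinM.
  have <- : lint (fun t => if J t then 1 else 0) = (s * r')%:E.
    rewrite lint_itv; last by rewrite ler_peMr ?(ltW s0)//; lra.
    by congr EFin; ring.
  rewrite -lintZ// -lintD//; last 3 first.
  - exact: measurable_mean_integrand.
  - exact: measurable_funM.
  - by move=> t; rewrite mulr_ge0.
  apply: (@le_trans _ _ (lint (fun t =>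
      (L + g / 8) * q t + M * (if t < th then q t else 0)))).
    apply: le_lint.
    - apply: measurable_funD; first exact: measurable_mean_integrand.
      exact: measurable_funM.
    - by apply: measurable_funD; exact: measurable_funM.
    - move=> t; apply/andP; split.
        by rewrite addr_ge0// mulr_ge0.
      have qt := q0 t; have /andP[Atx0 AtxM] := AM (t * x).
      case: ifPn => [/[dup] /Jlow Aj /Jq qj|_].
        have : 0 <= M * (if t < th then q t else 0) by rewrite mulr_ge0.
        by move: (M * _) => z z0; nra.
      rewrite mulr0 addr0; case: ifPn => [_|]; first by nra.
      rewrite -leNgt => tht; rewrite mulr0 addr0 ler_wpM2r//.
      apply: NP; move: Nx; rewrite ler_pdivrMr// => /le_trans; apply.
      by rewrite mulrC ler_wpM2r// ltW.
  rewrite lintD//; last 4 first.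
  - exact: measurable_funM.
  - exact: measurable_funM.
  - by move=> t; rewrite mulr_ge0.
  - by move=> t; rewrite mulr_ge0.
  rewrite !lintZ// (log_density_mass qd) mule1 [leRHS]EFinD leeD2l//.
  apply: (@le_trans _ _ (M%:E * (g / 8 / (M + 1))%:E)%E).
    by apply: lee_wpmul2l; rewrite ?lee_fin.
  rewrite -EFinM lee_fin mulrA ler_pdivrMr; last lra.
  by nra.
have gs : g <= eta / 2 * c * (s * r').
  by rewrite ler_wpM2l// ler_wpM2r// ltW.
have := Aerr x X0x; have := eP x Xex.
rewrite !ler_norml => ? /andP[_ ?]; lra.
Qed.

End RenewalSolutions.

(** * Spreading of near-maximal values *)

Section NearMaximalWindows.
Context {R : realType}.
Implicit Types (A : R -> R).

(** Multiplying [w] and [v] by the bounds of one more step, and merging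
    overlapping stretches, both preserve this quantifier pattern; hence its
    form, with [delta] and [X] chosen after [eta]. *)
Definition carries A (L w v : R) : Prop := forall eta, 0 < eta ->
  exists delta X : R, [/\ 0 < delta, 0 < X &
    forall x, X <= x -> L - delta <= A x ->
    forall y, w * x <= y <= v * x -> L - eta <= A y].

Lemma carries1 A (L : R) : carries A L 1 1.
Proof.
move=> eta eta0; exists eta, 1; split=> // x _ Ax y.
by rewrite !mul1r => /le_anti <-.
Qed.

Lemma carriesM A (L al be w v : R) : 0 < al -> al <= be -> 0 < w -> w <= v ->
  carries A L al be -> carries A L w v -> carries A L (al * w) (be * v).
Proof.
move=> al0 albe w0 wv step win eta eta0.
have [d1 [X1 [d10 X10 H1]]] := step _ eta0.
have [d2 [X2 [d20 X20 H2]]] := win _ d10.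
exists d2, (Num.max X2 (X1 / w)); split=> //.
  by rewrite lt_max X20.
move=> x; rewrite ge_max => /andP[X2x X1x] Ax y /andP[ly yu].
have x0 : 0 < x by lra.
have be0 : 0 < be by lra.
(* An intermediate point of the stretch of [x], one step away from [y]. *)
pose z := Num.max (w * x) (y / be).
have wz : w * x <= z by rewrite le_max lexx.
have zv : z <= v * x.
  by rewrite ge_max ler_wpM2r ?(ltW x0)//= ler_pdivrMr// (mulrC _ be) mulrA.
have yz : y <= be * z.
  by rewrite mulrC -ler_pdivrMr// le_max lexx orbT.
have zy : al * z <= y.
  rewrite /z maxr_pMr ?(ltW al0)// ge_max mulrA ly/=.
  have y0 : 0 < y by rewrite (lt_le_trans _ ly)// !mulr_gt0.
  by rewrite mulrCA ger_pMr// ler_pdivrMr// mul1r.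
apply: (H1 z); last by rewrite zy.
- by rewrite (le_trans _ wz)// mulrC -ler_pdivrMr.
- by apply: (H2 x) => //; rewrite wz.
Qed.

Lemma carriesU A (L w1 v1 w2 v2 : R) : w1 <= v2 ->
  carries A L w1 v1 -> carries A L w2 v2 -> carries A L w2 v1.
Proof.
move=> w1v2 win1 win2 eta eta0.
have [d1 [X1 [d10 X10 H1]]] := win1 _ eta0.
have [d2 [X2 [d20 X20 H2]]] := win2 _ eta0.
exists (Num.min d1 d2), (Num.max X1 X2); split.
- by rewrite lt_min d10.
- by rewrite lt_max X10.
move=> x; rewrite ge_max => /andP[X1x X2x] Ax y /andP[ly yu].
have [d1m d2m] : Num.min d1 d2 <= d1 /\ Num.min d1 d2 <= d2.
  by rewrite !ge_min !lexx orbT.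
have [w1y|yw1] := leP (w1 * x) y.
  by apply: (H1 x) => //; [lra|rewrite w1y].
apply: (H2 x) => //; [lra|rewrite ly/=].
by rewrite (le_trans (ltW yw1))// ler_wpM2r//; lra.
Qed.

(** A single step carries from [x] to [al * x, be * x] and [n] steps carry to
    [al ^+ n * x, be ^+ n * x]; once [al ^+ n <= be ^+ n.+1] consecutive
    stretches overlap, and their union has arbitrarily large ratio. *)
Lemma carries_wide A (L al be th : R) :
  0 < al -> al < be -> be < 1 -> 0 < th -> carries A L al be ->
  exists w v : R, [/\ 0 < w, 0 < v, w <= th * v & carries A L w v].
Proof.
move=> al0 albe be1 th0 step.
have be0 : 0 < be by lra.
have powers n : carries A L (al ^+ n) (be ^+ n).
  elim: n => [|n IH]; first by rewrite !expr0; exact: carries1.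
  rewrite !exprS; apply: carriesM => //; first exact: ltW.
    exact: exprn_gt0.
  by rewrite lerXn2r ?nnegrE// ltW.
have small (x e : R) : 0 < x < 1 -> 0 < e -> exists n, x ^+ n <= e.
  move=> /andP[x0 x1] e0; have : `|x| < 1 by rewrite gtr0_norm.
  move=> /cvg_expr /(@cvgr_lt R nat) /(_ _ e0) H.
  near \oo => n; exists n; apply: ltW; near: n; exact: H.
have [n0 n0P] : exists n0, (al / be) ^+ n0 <= be.
  by apply: small => //; rewrite divr_gt0//= ltr_pdivrMr// mul1r.
have overlap : al ^+ n0 <= be ^+ n0.+1.
  move: n0P; rewrite expr_div_n ler_pdivrMr ?exprn_gt0//.
  by rewrite exprS.
have extend n : carries A L (al ^+ (n0 + n)) (be ^+ n0).
  elim: n => [|n IH]; first by rewrite addn0.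
  apply: (@carriesU A L _ _ (al ^+ (n0 + n.+1)) (be ^+ n0.+1) _ IH).
    apply: le_trans overlap; rewrite exprD.
    by rewrite ler_piMr ?exprn_ile1 ?exprn_ge0 ?(ltW al0)//; lra.
  rewrite addnS !exprS; apply: carriesM IH => //; first exact: ltW.
    exact: exprn_gt0.
  rewrite exprD (@le_trans _ _ (al ^+ n0))//.
    by rewrite ler_piMr ?exprn_ile1 ?exprn_ge0 ?(ltW al0)//; lra.
  by rewrite lerXn2r ?nnegrE// ltW.
have [n nP] : exists n, al ^+ n <= th by apply: small => //; rewrite al0; lra.
exists (al ^+ (n0 + n)), (be ^+ n0); split; rewrite ?exprn_gt0//.
rewrite exprD mulrC ler_pM ?exprn_ge0 ?(ltW al0)//.
by rewrite lerXn2r ?nnegrE// ltW.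
Unshelve. all: by end_near. Qed.

End NearMaximalWindows.

(** * The invariant measure [dz / z] *)

Section LogarithmicWeight.
Context {R : realType}.

(** The measure [dz / z] cut to the interval (a, b]; writing the inverse as a
    power keeps it nonnegative and measurable on the whole line. *)
Definition invcut (a b z : R) : R :=
  if (a < z) && (z <= b) then z `^ (-1) else 0.

Lemma invcut_ge0 a b z : 0 <= invcut a b z.
Proof. by rewrite /invcut; case: ifP => // _; exact: powR_ge0. Qed.

Lemma measurable_invcut d (T : measurableType d) (a b z : T -> R) :
  measurable_fun setT a -> measurable_fun setT b -> measurable_fun setT z ->
  measurable_fun setT (fun u => invcut (a u) (b u) (z u)).
Proof.
move=> ma mb mz; apply: measurable_guard.
  apply: measurable_and; first exact: measurable_fun_ltr.
  exact: measurable_fun_ler.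
by apply: (measurableT_comp (measurable_powR _)).
Qed.

Lemma invcut_split a b c z : a <= b -> b <= c ->
  invcut a b z + invcut b c z = invcut a c z.
Proof.
move=> ab bc; rewrite /invcut.
have [az|za] := ltP a z; last by rewrite ltNge (le_trans za ab)/= addr0.
have [zb|bz] := leP z b; last by rewrite add0r.
by rewrite (le_trans zb bc)/= addr0.
Qed.

Lemma invcut_dilation c a b z : 0 < c -> 0 < a ->
  c * invcut (c * a) (c * b) (c * z) = invcut a b z.
Proof.
move=> c0 a0; rewrite /invcut ltr_pM2l// ler_pM2l//.
case: ifP => [/andP[az _]|]; last by rewrite mulr0.
by rewrite !powR_inv1//; [field; lra|lra|nra].
Qed.

Lemma lint_cut (a b : R) (f : R -> R) :
  lint (fun z => if (a < z) && (z <= b) then f z else 0) =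
  (\int[@lebesgue_measure R]_(z in `]a, b]) (f z)%:E)%E.
Proof.
rewrite integral_mkcond; apply: eq_integral => z _; rewrite patchE.
case: ifPn => abz; first by rewrite mem_set//= in_itv.
by rewrite memNset//= in_itv/=; exact/negP.
Qed.

Lemma lint_cut_FTC (a b : R) (f F : R -> R) : a <= b ->
  (forall z, a <= z <= b -> {for z, continuous f}) ->
  (forall z, a <= z <= b -> is_derive z 1 F (f z)) ->
  measurable_fun setT f ->
  lint (fun z => if (a < z) && (z <= b) then f z else 0) = (F b - F a)%:E.
Proof.
move=> ab cf dF mf; rewrite lint_cut.
have [<-{b ab cf dF}|nab] := eqVneq a b.
  by rewrite subrr set_itvoc0 integral_set0.
have ltab : a < b by rewrite lt_neqAle nab.
rewrite integral_itv_obnd_cbnd; last first.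
  by apply/measurable_EFinP; exact: measurable_funTS.
have cF z : a <= z <= b -> {for z, continuous F}.
  by move=> /dF [dz _]; apply: differentiable_continuous; exact/derivable1_diffP.
rewrite (@continuous_FTC2 _ f F)//.
- apply: continuous_in_subspaceT => z /set_mem/=; rewrite in_itv/=; exact: cf.
- split.
  + by move=> z; rewrite in_itv/= => /andP[az zb]; apply: (dF z _).(ex_derive);
      rewrite !ltW.
  + by apply: cvg_at_right_filter; apply: cF; rewrite lexx.
  + by apply: cvg_at_left_filter; apply: cF; rewrite lexx andbT.
- move=> z; rewrite in_itv/= => /andP[az zb]; rewrite derive1E.
  by apply: derive_val; apply: dF; rewrite !ltW.
Qed.

Lemma lint_invcut (a b : R) : 0 < a -> a <= b ->
  lint (invcut a b) = (ln b - ln a)%:E.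
Proof.
move=> a0 ab; apply: lint_cut_FTC => //.
- move=> z /andP[az _]; have z0 : 0 < z by exact: lt_le_trans az.
  apply: differentiable_continuous; apply/derivable1_diffP.
  exact: (is_derive1_powR (-1) z0).(ex_derive).
- move=> z /andP[az _]; have z0 : 0 < z by exact: lt_le_trans az.
  rewrite powR_inv1 ?ltW//; exact: is_derive1_ln.
Qed.

Lemma lint_invcut_powRN (kappa a b : R) : 0 < kappa -> 0 < a -> a <= b ->
  (lint (fun z => invcut a b z * z `^ (- kappa))%R
    <= (kappa^-1 * a `^ (- kappa))%:E)%E.
Proof.
move=> k0 a0 ab.
have -> : lint (fun z => invcut a b z * z `^ (- kappa)) =
  lint (fun z => if (a < z) && (z <= b) then z `^ (- kappa - 1) else 0).
  apply: eq_lint => z; rewrite /invcut; case: ifP => [/andP[az _]|].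
    by rewrite -powRD 1?addrC// (gt_eqF (lt_trans a0 az)) implybT.
  by rewrite mul0r.
pose F (z : R) := - kappa^-1 * z `^ (- kappa).
rewrite (_ : lint _ = (F b - F a)%:E); last apply: lint_cut_FTC => //.
- rewrite lee_fin; have := powR_ge0 b (- kappa).
  have : 0 < kappa^-1 by rewrite invr_gt0.
  by rewrite /F; nra.
- move=> z /andP[az _]; have z0 : 0 < z by exact: lt_le_trans az.
  apply: differentiable_continuous; apply/derivable1_diffP.
  exact: (is_derive1_powR (- kappa - 1) z0).(ex_derive).
- move=> z /andP[az _]; have z0 : 0 < z by exact: lt_le_trans az.
  have -> : z `^ (- kappa - 1) =
      - kappa^-1 * (- kappa * z `^ (- kappa - 1)).
    by field; lra.
  exact: (is_deriveZ (- kappa^-1) (is_derive1_powR (- kappa) z0)).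
Qed.

End LogarithmicWeight.

(** * Iterated integrals of nonnegative functions *)

Section IteratedIntegrals.
Context {R : realType}.
Implicit Types (G H : R -> R -> R).

Definition dint G : \bar R := (\int[@lebesgue_measure R]_t lint (G t))%E.

Definition measurable2 G := measurable_fun setT (fun u : R * R => G u.1 u.2).

Lemma measurable2_section G t : measurable2 G -> measurable_fun setT (G t).
Proof.
move=> mG; have mp : measurable_fun setT (fun z : R => (t, z)).
  exact: measurable_pair1.
exact: (measurableT_comp mG mp).
Qed.

Lemma measurable_lint G : measurable2 G -> (forall t z, 0 <= G t z) ->
  measurable_fun setT (fun t => lint (G t)).
Proof.
move=> mG G0.
have mE : measurable_fun setT (fun u : R * R => (G u.1 u.2)%:E).
  exact/measurable_EFinP.
apply: (measurable_fun_fubini_tonelli_F (m2 := @lebesgue_measure R) _ mE).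
by move=> u; rewrite lee_fin.
Qed.

Lemma dint_flip G : measurable2 G -> (forall t z, 0 <= G t z) ->
  dint G = dint (fun z t => G t z).
Proof.
move=> mG G0.
have mE : measurable_fun setT (fun u : R * R => (G u.1 u.2)%:E).
  exact/measurable_EFinP.
apply: (fubini_tonelli (m1 := @lebesgue_measure R)
  (m2 := @lebesgue_measure R) _ mE).
by move=> u; rewrite lee_fin.
Qed.

Lemma dintD G H : measurable2 G -> measurable2 H ->
  (forall t z, 0 <= G t z) -> (forall t z, 0 <= H t z) ->
  dint (fun t z => G t z + H t z) = (dint G + dint H)%E.
Proof.
move=> mG mH G0 H0; rewrite /dint.
under eq_integral => t _.
  rewrite lintD//; [|exact: measurable2_section|exact: measurable2_section].
  over.
rewrite ge0_integralD//.
- by move=> t _; exact: lint_ge0.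
- exact: measurable_lint.
- by move=> t _; exact: lint_ge0.
- exact: measurable_lint.
Qed.

Lemma eq_dint G H : (forall t z, G t z = H t z) -> dint G = dint H.
Proof. by move=> GH; apply: eq_integral => t _; exact: eq_lint. Qed.

End IteratedIntegrals.

(** * The almost conserved potential *)

Section ConservedQuantity.
Context {R : realType}.
Variables (q : R -> R) (qd : log_density q).
Implicit Types (A : R -> R).

Let mq := log_density_measurable qd.
Let q0 := log_density_ge0 qd.
Let qout := log_density_out qd.

(** In logarithmic coordinates this is the convolution of [A] with the tail of
    the step distribution, the classical invariant of renewal equations. *)
Definition renewal_potential A (x : R) : \bar R :=
  dint (fun t z => q t * (invcut (t * x) x z * A z)).

Definition log_moment : R := fine (lint (fun t => q t * ln t^-1)).

Lemma log_moment_integrand_ge0 t : 0 <= q t * ln t^-1.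
Proof.
have [/andP[t0 t1]|/qout->] := boolP (0 < t < 1); last by rewrite mul0r.
by rewrite mulr_ge0// ln_ge0// invf_ge1// ltW.
Qed.

Lemma measurable_log_moment_integrand :
  measurable_fun setT (fun t : R => q t * ln t^-1).
Proof.
have -> : (fun t : R => q t * ln t^-1) = (fun t => q t * - ln t).
  apply/funext => t.
  have [/andP[t0 t1]|/qout->] := boolP (0 < t < 1); last by rewrite !mul0r.
  by rewrite lnV// posrE.
apply: measurable_funM => //; apply: measurable_funN.
exact: measurable_ln.
Qed.

Lemma log_momentE : log_moment%:E = lint (fun t => q t * ln t^-1).
Proof.
rewrite /log_moment fineK// ge0_fin_numE; first exact: (log_density_moment qd).
by apply: lint_ge0 => t; exact: log_moment_integrand_ge0.
Qed.

Lemma log_moment_gt0 : 0 < log_moment.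
Proof.
have [a [b [c [a0 ab b1 c0 qc]]]] := log_density_pos qd.
have lnb : 0 < ln b^-1 by rewrite ln_gt0// invf_gt1//; lra.
suff : c * ln b^-1 * (b - a) <= log_moment.
  by apply: lt_le_trans; rewrite !mulr_gt0// subr_gt0.
have k0 : 0 <= c * ln b^-1 by rewrite mulr_ge0// ltW.
have mcut : measurable_fun setT
    (fun t : R => if (a < t) && (t <= b) then 1 else 0 : R).
  apply: measurable_guard => //; apply: measurable_and.
    exact: measurable_fun_ltr.
  exact: measurable_fun_ler.
rewrite -lee_fin EFinM log_momentE -lint_itv ?(ltW ab)// -lintZ//; last first.
  by move=> t; case: ifP.
apply: le_lint.
- exact: measurable_funM.
- exact: measurable_log_moment_integrand.
- move=> t; apply/andP; split; first by rewrite mulr_ge0//; case: ifP.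
  case: ifP => [/andP[at_ tb]|_]; last first.
    by rewrite mulr0 log_moment_integrand_ge0.
  rewrite mulr1 ler_pM ?(ltW c0) ?(ltW lnb)//.
    by apply: qc; rewrite (ltW at_).
  by rewrite ler_ln ?posrE ?invr_gt0//; [rewrite lef_pV2// posrE; lra|lra|lra].
Qed.

Section Solution.
Variables (A : R -> R) (M D kappa X0 : R).
Hypothesis Asol : renewal_solution q A M D kappa X0.

Let mA := renewal_measurable Asol.
Let AM := renewal_bounded Asol.

Let A0 x : 0 <= A x. Proof. by case/andP: (AM x). Qed.
Let M0 : 0 <= M. Proof. by case/andP: (AM 0); exact: le_trans. Qed.

Let D0 : 0 <= D.
Proof.
have := le_trans (normr_ge0 _) (renewal_error Asol (lexx X0)).
by rewrite pmulr_lge0// powR_gt0//; exact: renewal_start Asol.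
Qed.

Let mlinM (x : R) : measurable_fun setT (fun u : R * R => u.1 * x).
Proof. by apply: measurable_funM => //; exact: measurable_fst. Qed.

Let mfst (f : R -> R) : measurable_fun setT f ->
  measurable_fun setT (fun u : R * R => f u.1).
Proof. by move=> mf; apply: (measurableT_comp mf); exact: measurable_fst. Qed.

Let msnd (f : R -> R) : measurable_fun setT f ->
  measurable_fun setT (fun u : R * R => f u.2).
Proof. by move=> mf; apply: (measurableT_comp mf); exact: measurable_snd. Qed.

Lemma measurable2_weighted (a b : R * R -> R) (f : R -> R) :
  measurable_fun setT a -> measurable_fun setT b -> measurable_fun setT f ->
  measurable2 (fun t z => q t * (invcut (a (t, z)) (b (t, z)) z * f z)).
Proof.
move=> ma mb mf; apply: measurable_funM; first exact: mfst.
apply: measurable_funM; last exact: msnd.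
rewrite (_ : (fun u : R * R => _) =
  (fun u : R * R => invcut (a u) (b u) u.2)); last first.
  by apply/funext => -[].
by apply: measurable_invcut => //; exact: measurable_snd.
Qed.

Let weight_ge0 (a b t z : R) (f : R -> R) : (forall z, 0 <= f z) ->
  0 <= q t * (invcut a b z * f z).
Proof. by move=> f0; rewrite mulr_ge0// mulr_ge0// invcut_ge0. Qed.

(** Moving the window from [x] to [x'] adds the mass of [A z / z] over
    ]x, x'] and removes, for each ratio [t], the mass over ]t x, t x'], which
    is the mass of [A (t y) / y] over ]x, x']. *)
Lemma renewal_potential_balance x x' : 0 < x -> x <= x' ->
  (renewal_potential A x + lint (fun z => invcut x x' z * A z)%R =
   renewal_potential A x' +
     dint (fun y t => q t * (invcut x x' y * A (t * y)))%R)%E.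
Proof.
move=> x0 xx'.
have mx (y : R) : measurable_fun setT (fun u : R * R => u.1 * y) by exact: mlinM.
have mcst (y : R) : measurable_fun setT (fun _ : R * R => y) by [].
pose P2 t z := q t * (invcut x x' z * A z).
pose Q2 t z := q t * (invcut (t * x) (t * x') z * A z).
have P2E : dint P2 = lint (fun z => invcut x x' z * A z).
  rewrite dint_flip; last 2 first.
  - exact: (measurable2_weighted (mcst x) (mcst x') mA).
  - by move=> t z; exact: weight_ge0.
  apply: eq_integral => z _.
  rewrite (@eq_lint _ _ (fun t => (invcut x x' z * A z) * q t)); last first.
    by move=> t; rewrite /P2 mulrC.
  by rewrite lintZ// ?(log_density_mass qd) ?mule1// mulr_ge0// invcut_ge0.
have Q2E : dint Q2 = dint (fun y t => q t * (invcut x x' y * A (t * y))).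
  rewrite [RHS]dint_flip; last 2 first.
  - apply: measurable_funM; first exact: msnd.
    apply: measurable_funM.
      apply: measurable_invcut => //; exact: measurable_fst.
    apply: (measurableT_comp mA); apply: measurable_funM.
      exact: measurable_snd.
    exact: measurable_fst.
  - by move=> y t; rewrite mulr_ge0// mulr_ge0// invcut_ge0.
  apply: eq_integral => t _.
  have [/andP[t0 t1]|/qout qt] := boolP (0 < t < 1); last first.
    by apply: eq_lint => z; rewrite /Q2 qt !mul0r.
  rewrite -(@lint_dilation _ t)//.
  - apply: eq_lint => z; rewrite /Q2 -(@invcut_dilation _ t x x' z)//.
    by ring.
  - apply: (@measurable2_section _ Q2).
    exact: (measurable2_weighted (mx x) (mx x') mA).
  - by move=> z; exact: weight_ge0.
(* For fixed [t], both sides integrate [A z / z] from [t * x] to [x'], cut at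
   [x] on the left and at [t * x'] on the right. *)
rewrite -P2E -Q2E /renewal_potential -dintD; last 4 first.
- exact: (measurable2_weighted (mx x) (mcst x) mA).
- exact: (measurable2_weighted (mcst x) (mcst x') mA).
- by move=> t z; exact: weight_ge0.
- by move=> t z; exact: weight_ge0.
rewrite -dintD; last 4 first.
- exact: (measurable2_weighted (mx x') (mcst x') mA).
- exact: (measurable2_weighted (mx x) (mx x') mA).
- by move=> t z; exact: weight_ge0.
- by move=> t z; exact: weight_ge0.
apply: eq_dint => t z; rewrite /P2 /Q2.
have [/andP[t0 t1]|/qout qt] := boolP (0 < t < 1); last by rewrite qt !mul0r.
rewrite -!mulrDr -!mulrDl; congr (_ * (_ * _)).
rewrite invcut_split//; last by nra.
by rewrite addrC invcut_split//; nra.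
Qed.

(** Applied to [A] and to [M - A], this carries a lower bound on either potential
    from one point to all later ones, up to the error still to be accumulated,
    which is at most the integral of [D * y `^ (- kappa - 1)] from [x] on. *)
Lemma renewal_potential_almost_increasing x x' : X0 <= x -> x <= x' ->
  (renewal_potential A x <=
   renewal_potential A x' + (D / kappa * x `^ (- kappa))%:E)%E.
Proof.
move=> X0x xx'; have X00 := renewal_start Asol.
have x0 : 0 < x by lra.
have minv : measurable_fun setT (fun z : R => invcut x x' z).
  exact: measurable_invcut.
have mh : measurable_fun setT (fun z : R => invcut x x' z * A z).
  exact: measurable_funM.
have h0 z : 0 <= invcut x x' z * A z by rewrite mulr_ge0// invcut_ge0.
have me : measurable_fun setT (fun z : R => invcut x x' z * z `^ (- kappa)).
  by apply: measurable_funM => //; exact: measurable_powR.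
have e0 (z : R) : 0 <= invcut x x' z * z `^ (- kappa).
  by rewrite mulr_ge0 ?powR_ge0// invcut_ge0.
have hfin : lint (fun z => invcut x x' z * A z) \is a fin_num.
  rewrite ge0_fin_numE ?lint_ge0//.
  apply: (@le_lt_trans _ _ (lint (fun z => M * invcut x x' z))).
    apply: le_lint => //; first exact: measurable_funM.
    move=> z; rewrite h0 mulrC ler_wpM2r ?invcut_ge0//.
    by case/andP: (AM z).
  rewrite lintZ//; last by move=> z; exact: invcut_ge0.
  by rewrite (lint_invcut x0 xx') -EFinM ltry.
rewrite -(leeD2rE _ _ hfin) renewal_potential_balance//.
rewrite -[leRHS]addeA leeD2l// addeC.
apply: (@le_trans _ _ (lint (fun z =>
    invcut x x' z * A z + D * (invcut x x' z * z `^ (- kappa))))).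
  apply: ge0_le_integral => //.
  - move=> y _; apply: lint_ge0 => t.
    by rewrite mulr_ge0// mulr_ge0// invcut_ge0.
  - apply: measurable_lint; last first.
      by move=> y t; rewrite mulr_ge0// mulr_ge0// invcut_ge0.
    apply: measurable_funM; first exact: msnd.
    apply: measurable_funM.
      apply: measurable_invcut => //; exact: measurable_fst.
    apply: (measurableT_comp mA); apply: measurable_funM.
      exact: measurable_snd.
    exact: measurable_fst.
  - by apply/measurable_EFinP; apply: measurable_funD => //;
      apply: measurable_funM.
  - move=> y _.
    rewrite (@eq_lint _ _ (fun t => invcut x x' y * (A (t * y) * q t)));
      last by move=> t; ring.
    rewrite lintZ ?invcut_ge0//; last 2 first.
    + exact: measurable_mean_integrand.
    + by move=> t; rewrite mulr_ge0.
    rewrite -(rmeanE qd _ mA AM) -EFinM lee_fin.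
    have [/andP[xy yx']|/negbTE xyx'] := boolP ((x < y) && (y <= x')); last first.
      by rewrite /invcut xyx' !mul0r mulr0 addr0.
    rewrite mulrCA -mulrDr ler_wpM2l ?invcut_ge0//.
    have := renewal_error Asol (_ : X0 <= y).
    by move=> /(_ ltac:(lra)); rewrite ler_norml => /andP[? _]; lra.
rewrite lintD//; last 2 first.
- exact: measurable_funM.
- by move=> z; rewrite mulr_ge0.
rewrite leeD2l// lintZ//.
rewrite -mulrA EFinM lee_wpmul2l ?lee_fin//.
exact: (lint_invcut_powRN (renewal_rate Asol) x0 xx').
Qed.

End Solution.
End ConservedQuantity.

(** * Convergence of renewal solutions *)

Section Convergence.
Context {R : realType}.
Variables (q : R -> R) (qd : log_density q).
Implicit Types (A : R -> R).

Let mq := log_density_measurable qd.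
Let q0 := log_density_ge0 qd.
Let qout := log_density_out qd.
Let Lambda t := q t * ln t^-1.
Let Lambda0 t : 0 <= Lambda t := log_moment_integrand_ge0 qd t.
Let mLambda : measurable_fun setT Lambda := measurable_log_moment_integrand qd.

Lemma lint_weighted_invcut (x t : R) : 0 < x ->
  lint (fun z => q t * invcut (t * x) x z) = (Lambda t)%:E.
Proof.
move=> x0; have minv : measurable_fun setT (fun z : R => invcut (t * x) x z).
  exact: measurable_invcut.
rewrite lintZ//; last by move=> z; exact: invcut_ge0.
have [/andP[t0 t1]|/qout qt] := boolP (0 < t < 1); last first.
  by rewrite /Lambda qt mul0r mul0e.
rewrite lint_invcut ?mulr_gt0//; last by rewrite ler_piMl ?ltW.
by rewrite lnM ?posrE// /Lambda lnV ?posrE// -EFinM; congr EFin; ring.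
Qed.

Lemma measurable2_potential A (x : R) : measurable_fun setT A ->
  measurable2 (fun t z => q t * (invcut (t * x) x z * A z)).
Proof.
move=> mA; apply: (measurable2_weighted qd (a := fun u => u.1 * x)
  (b := fun=> x)) => //.
by apply: measurable_funM => //; exact: measurable_fst.
Qed.

Lemma potential_integrand_ge0 A (x t z : R) : (forall x, 0 <= A x) ->
  0 <= q t * (invcut (t * x) x z * A z).
Proof. by move=> A0; rewrite !mulr_ge0// invcut_ge0. Qed.

Lemma renewal_potential_complement A (M x : R) : measurable_fun setT A ->
  (forall x, 0 <= A x <= M) -> 0 < x ->
  (renewal_potential q A x + renewal_potential q (fun y => M - A y)%R x =
    (M * log_moment q)%:E)%E.
Proof.
move=> mA AM x0; have M0 : 0 <= M by case/andP: (AM 0); exact: le_trans.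
rewrite -dintD; last 4 first.
- exact: measurable2_potential.
- apply: (@measurable2_potential (fun y => M - A y)).
  exact: measurable_funB.
- by move=> t z; apply: potential_integrand_ge0 => y; case/andP: (AM y).
- by move=> t z; apply: (@potential_integrand_ge0 (fun y => M - A y)) => y;
    rewrite subr_ge0;
    case/andP: (AM y).
rewrite EFinM (log_momentE qd) -lintZ//.
apply: eq_integral => t _.
rewrite (@eq_lint _ _ (fun z => M * (q t * invcut (t * x) x z))); last first.
  by move=> z; ring.
rewrite lintZ//; last 2 first.
- by apply: measurable_funM => //; exact: measurable_invcut.
- by move=> z; rewrite mulr_ge0// invcut_ge0.
by rewrite lint_weighted_invcut// -EFinM.
Qed.

(** For constant [A] equal to [L] the potential is [L * log_moment q]; the ratios
    below [th], for which nothing is known about [A], cost at most the part of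
    the log-moment they carry. *)
Lemma renewal_potential_lower A (L eta th x : R) : measurable_fun setT A ->
  (forall y, 0 <= A y) -> 0 <= L -> 0 <= eta -> 0 < x ->
  (forall y, th * x <= y <= x -> L - eta <= A y) ->
  ((L * log_moment q)%:E <= renewal_potential q A x +
    ((eta * log_moment q)%:E +
     L%:E * lint (fun t => if t < th then Lambda t else 0)%R))%E.
Proof.
move=> mA A0 L0 eta0 x0 Alow.
have mtail : measurable_fun setT (fun t : R => if t < th then Lambda t else 0).
  by apply: measurable_guard => //; exact: measurable_fun_ltr.
have tail0 t : 0 <= (if t < th then Lambda t else 0) by case: ifP.
have etaL0 t : 0 <= eta * Lambda t by rewrite mulr_ge0.
have Ltail0 t : 0 <= L * (if t < th then Lambda t else 0) by rewrite mulr_ge0.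
have metaL : measurable_fun setT (fun t : R => eta * Lambda t).
  exact: measurable_funM.
have mLtail : measurable_fun setT
    (fun t : R => L * (if t < th then Lambda t else 0)).
  exact: measurable_funM.
rewrite !EFinM (log_momentE qd) -(lintZ mtail tail0 L0).
rewrite -(lintZ mLambda Lambda0 L0) -(lintZ mLambda Lambda0 eta0) -lintD//.
have mpot : measurable_fun setT
    (fun t : R => lint (fun z => q t * (invcut (t * x) x z * A z))).
  apply: (@measurable_lint _ (fun t z => q t * (invcut (t * x) x z * A z))).
    exact: measurable2_potential.
  by move=> t z; exact: potential_integrand_ge0.
have merr : measurable_fun setT (fun t : R => (eta * Lambda t +
    L * (if t < th then Lambda t else 0))%:E).
  by apply/measurable_EFinP; apply: measurable_funD => //;
    exact: measurable_funM.
rewrite /renewal_potential /dint {2}/lint -ge0_integralD//; last 2 first.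
- by move=> t _; apply: lint_ge0 => z; exact: potential_integrand_ge0.
- by move=> t _; rewrite lee_fin addr_ge0// mulr_ge0.
apply: ge0_le_integral => //.
- by move=> t _; rewrite lee_fin mulr_ge0.
- by apply/measurable_EFinP; exact: measurable_funM.
- exact: emeasurable_funD.
move=> t _; have [tth|tht] := ltP t th.
  rewrite -[leLHS]add0e leeD ?lint_ge0//.
    by move=> z; exact: potential_integrand_ge0.
  by rewrite lee_fin lerDr mulr_ge0.
have minv : measurable_fun setT (fun z : R => q t * invcut (t * x) x z).
  by apply: measurable_funM => //; exact: measurable_invcut.
have inv0 z : 0 <= q t * invcut (t * x) x z by rewrite mulr_ge0// invcut_ge0.
have mpt : measurable_fun setT
    (fun z : R => q t * (invcut (t * x) x z * A z)).
  exact: (measurable2_section t (measurable2_potential x mA)).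
have pt0 z : 0 <= q t * (invcut (t * x) x z * A z).
  exact: potential_integrand_ge0.
have minvZ (c : R) : measurable_fun setT
    (fun z : R => c * (q t * invcut (t * x) x z)) by exact: measurable_funM.
rewrite mulr0 addr0 (EFinM L) (EFinM eta) -!(@lint_weighted_invcut x t)// -!lintZ//.
rewrite -lintD//; last by move=> z; rewrite mulr_ge0.
apply: le_lint => //; first exact: measurable_funD.
move=> z; rewrite mulr_ge0//=.
have [/andP[tz zx]|/negbTE nz] := boolP ((t * x < z) && (z <= x)); last first.
  by rewrite /invcut nz; lra.
have : L - eta <= A z.
  apply: Alow; rewrite zx andbT (le_trans _ (ltW tz))//.
  by rewrite ler_pM2r.
by have := inv0 z; move: (q t) (invcut _ _ _) => u v; nra.
Qed.

Lemma renewal_solution_complement A (M D kappa X0 : R) :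
  renewal_solution q A M D kappa X0 ->
  renewal_solution q (fun y => M - A y) M D kappa X0.
Proof.
move=> [mA AM k0 X00 Aerr].
have mB : measurable_fun setT (fun y => M - A y) by exact: measurable_funB.
have BM x : 0 <= M - A x <= M.
  by have := AM x => /andP[? ?]; apply/andP; split; lra.
have M0 : 0 <= M by case/andP: (AM 0); exact: le_trans.
split=> // x X0x.
have -> : rmean q (fun y => M - A y) x = M - rmean q A x.
  suff : rmean q (fun y => M - A y) x + rmean q A x = M.
    exact: canRL (addrK _).
  apply/eqP; rewrite -eqe EFinD; apply/eqP.
  rewrite (rmeanE qd _ mA AM) (rmeanE qd _ mB BM) -lintD//; last 4 first.
  - exact: (measurable_mean_integrand qd _ mB).
  - exact: (measurable_mean_integrand qd _ mA).
  - by move=> t; rewrite mulr_ge0//; case/andP: (BM (t * x)).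
  - by move=> t; rewrite mulr_ge0//; case/andP: (AM (t * x)).
  rewrite (@eq_lint _ _ (fun t => M * q t)); last by move=> t; ring.
  by rewrite lintZ// (log_density_mass qd) mule1.
have -> : M - A x - (M - rmean q A x) = - (A x - rmean q A x) by ring.
by rewrite normrN; exact: Aerr.
Qed.

Definition limsup_value A (L : R) : Prop :=
  (forall delta, 0 < delta -> exists X, forall x, X <= x -> A x <= L + delta) /\
  (forall delta X, 0 < delta -> exists2 x, X <= x & L - delta <= A x).

Lemma limsup_value_exists A (M : R) : (forall x, 0 <= A x <= M) ->
  exists2 L, 0 <= L & limsup_value A L.
Proof.
move=> AM; pose U := [set c : R | exists X, forall x, X <= x -> A x <= c].
have U0 c : U c -> 0 <= c.
  move=> [X HX]; apply: le_trans (HX X (lexx _)); by case/andP: (AM X).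
have Uinf : has_inf U.
  split; last by exists 0; move=> c /U0.
  by exists M, 0 => x _; case/andP: (AM x).
exists (inf U); first by apply: lb_le_inf; [exact: Uinf.1|move=> c /U0].
split=> [delta d0|delta X d0].
  have [c [X HX] cU] := inf_adherent d0 Uinf.
  by exists X => x /HX /le_trans; apply; exact: ltW.
apply: contrapT => nex.
have : inf U <= inf U - delta.
  apply: ge_inf; first exact: Uinf.2.
  exists X => x Xx; rewrite leNgt; apply/negP => Ax.
  by apply: nex; exists x => //; exact: ltW.
by lra.
Qed.

(** At suitable arguments the potential is computed over a long stretch where
    the solution is close to [L]; near-monotonicity does the rest. *)
Lemma renewal_potential_limsup A (M D kappa X0 L eps : R) :
  renewal_solution q A M D kappa X0 -> 0 <= L -> limsup_value A L -> 0 < eps ->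
  exists X, forall x, X <= x ->
    ((L * log_moment q)%:E <= renewal_potential q A x + eps%:E)%E.
Proof.
move=> Asol L0 [AL Afreq] eps0; have [mA AM k0 X00 Aerr] := Asol.
have A0 y : 0 <= A y by case/andP: (AM y).
have m0 := log_moment_gt0 qd.
have eps30 : 0 < eps / 3 by lra.
have [al [be [al0 albe be1 step]]] := renewal_step qd Asol AL.
have epsL : 0 < eps / 3 / (L + 1) by rewrite divr_gt0//; lra.
have [th /andP[th0 th1] tail] : exists2 th : R, 0 < th < 1 &
    (lint (fun t => if t < th then Lambda t else 0)%R
      <= (eps / 3 / (L + 1))%:E)%E.
  apply: lint_near0_small => //; last exact: (log_density_moment qd).
  by move=> t t0; rewrite /Lambda qout ?mul0r// ltNge t0.
have [w [v [w0 v0 wv win]]] := carries_wide al0 albe be1 th0 step.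
have eta0 : 0 < eps / 3 / log_moment q by rewrite divr_gt0.
have [delta [X1 [delta0 X10 near_L]]] := win _ eta0.
have [X2 X20 drift] := powRN_small (D / kappa) k0 eps30.
(* The potential is evaluated at the right end [v * x0] of the stretch, so
   the bounds needed there are divided by [v]. *)
have [x0 Xx0 Ax0] := Afreq delta (Num.max X1 (Num.max X0 X2 / v)) delta0.
move: Xx0; rewrite ge_max => /andP[X1x0].
rewrite ler_pdivrMr// ge_max mulrC => /andP[X0x X2x].
exists (v * x0) => x xx.
have vx0 : 0 < v * x0 by lra.
apply: (le_trans (renewal_potential_lower mA A0 L0 (ltW eta0) vx0 _ (th := th))).
  move=> y /andP[ly yu]; apply: (near_L x0) => //; rewrite yu andbT.
  by rewrite (le_trans _ ly)// mulrA ler_wpM2r//; lra.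
apply: (@le_trans _ _ (renewal_potential q A (v * x0) +
    ((eps / 3)%:E + (eps / 3)%:E))%E).
  rewrite leeD2l// leeD//; first by rewrite lee_fin divfK// gt_eqF.
  apply: (@le_trans _ _ (L%:E * (eps / 3 / (L + 1))%:E)%E).
    by apply: lee_wpmul2l; rewrite ?lee_fin.
  rewrite -EFinM lee_fin mulrA ler_pdivrMr; last lra.
  by nra.
have -> : eps%:E = ((eps / 3)%:E + ((eps / 3)%:E + (eps / 3)%:E))%E.
  by rewrite -!EFinD; congr EFin; lra.
rewrite [leRHS]addeA leeD2r//.
apply: (le_trans (renewal_potential_almost_increasing qd Asol X0x xx)).
by rewrite leeD2l// lee_fin; exact: drift.
Qed.

(** The potentials of [A] and [M - A] add up to [M * log_moment q], so the lower
    bounds that they obey force the two limsups to add up to at most [M], while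
    the limsup of [M - A] is [M] minus the liminf of [A]. *)
Lemma renewal_solution_cvg A (M D kappa X0 : R) :
  renewal_solution q A M D kappa X0 ->
  exists l : R, forall delta, 0 < delta ->
    exists X, forall x, X <= x -> `|A x - l| <= delta.
Proof.
move=> Asol; have Bsol := renewal_solution_complement Asol.
have [mA AM k0 X00 Aerr] := Asol.
have m0 := log_moment_gt0 qd.
have [L L0 LP] := limsup_value_exists AM.
have [L' L'0 L'P] := limsup_value_exists (renewal_bounded Bsol).
have LL' : L + L' <= M.
  rewrite leNgt; apply/negP => gap.
  pose eps := (L + L' - M) * log_moment q / 4.
  have eps0 : 0 < eps by rewrite !mulr_gt0//; lra.
  have [X XP] := renewal_potential_limsup Asol L0 LP eps0.
  have [X' X'P] := renewal_potential_limsup Bsol L'0 L'P eps0.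
  pose x := Num.max 1 (Num.max X X').
  have x0 : 0 < x by rewrite lt_max ltr01.
  have := leeD (XP x _) (X'P x _).
  move=> /(_ ltac:(by rewrite !le_max lexx orbT)).
  move=> /(_ ltac:(by rewrite !le_max lexx !orbT)).
  rewrite addeACA renewal_potential_complement// -!EFinD lee_fin.
  rewrite /eps; nra.
exists L => delta d0.
have [X XP] := LP.1 _ d0; have [X' X'P] := L'P.1 _ d0.
exists (Num.max X X') => x; rewrite ge_max => /andP[/XP ? /X'P ?].
by rewrite ler_norml; apply/andP; split; lra.
Qed.

End Convergence.

(** * From the recurrence to the renewal equation *)

Section Discretization.
Context {R : realType}.

Definition cut01 (p : R -> R) (t : R) : R := if 0 < t < 1 then p t else 0.

Lemma integral01E (f : R -> R) :
  (\int[@lebesgue_measure R]_(t in `]0%R, 1%R[) (f t)%:E)%E = lint (cut01 f).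
Proof.
rewrite integral_mkcond; apply: eq_integral => t _; rewrite patchE /cut01.
case: ifPn => t01; first by rewrite ifT//; move: t01; rewrite inE/= in_itv.
by rewrite ifF//; apply/negbTE; move: t01; rewrite notin_setE/= in_itv => /negP.
Qed.

Lemma measurable_cut01 (f : R -> R) :
  measurable_fun setT f -> measurable_fun setT (cut01 f).
Proof.
move=> mf; apply: measurable_guard => //; apply: measurable_and.
  exact: measurable_fun_ltr.
exact: measurable_fun_ltr.
Qed.

Lemma log_density_cut01 (p : R -> R) :
  continuous_density p -> finite_log_moment p -> log_density (cut01 p).
Proof.
move=> [pc p0 p1] plog; split.
- have mp : measurable_fun (`]0, 1[%classic : set R) p.
    by apply: open_continuous_measurable_fun; [exact: interval_open|];
      rewrite -continuous_open_subspace//; exact: interval_open.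
  have := (measurable_restrictT p (measurable_itv `]0 : R, 1 : R[)).1 mp.
  congr (measurable_fun _ _); apply/funext => t; rewrite patchE /cut01.
  case: ifPn => t01; first by rewrite ifT//; move: t01; rewrite inE/= in_itv.
  by rewrite ifF//; apply/negbTE; move: t01;
    rewrite notin_setE/= in_itv => /negP.
- by move=> t; rewrite /cut01; case: ifP => // /p0.
- by move=> t /negbTE t01; rewrite /cut01 t01.
- move=> t t01.
  have o01 : open (`]0, 1[%classic : set R) by exact: interval_open.
  have pt : {for t, continuous p}.
    have := pc; rewrite continuous_open_subspace// => /(_ t).
    by apply; rewrite inE/= in_itv.
  have near01 : \forall s \near t, p s = cut01 p s.
    have : nbhs t (`]0, 1[%classic : set R) by apply: open_nbhs_nbhs; split.
    apply: filterS => s /=; rewrite in_itv/= => s01.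
    by rewrite /cut01 s01.
  rewrite /prop_for /continuous_at {2}/cut01 t01.
  by apply: cvg_trans pt; exact: near_eq_cvg.
- by rewrite -integral01E.
- move: plog; rewrite /finite_log_moment integral01E; congr (_ < _)%E.
  apply: eq_lint => t; rewrite /cut01; case: ifP => _; last by rewrite mul0r.
  by rewrite mul1r.
Qed.

(** The fibres of a monotone integer-valued function are intervals. *)
Lemma measurable_step (c : R -> int) (g : int -> R) :
  {homo c : x y / x <= y >-> x <= y} -> measurable_fun setT (g \o c).
Proof.
move=> c_homo _ Y mY; rewrite setTI.
have -> : (g \o c) @^-1` Y =
    \bigcup_(i : int) [set t | c t = i /\ Y (g i)].
  apply/seteqP; split=> t /=; first by exists (c t).
  by move=> [i _ [<-]].
apply: countable_bigcupT_measurable => // i.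
apply: is_interval_measurable => s t [cs Yi] [ct _] u /andP[su ut]; split=> //.
by apply/le_anti/andP; split; [rewrite -ct|rewrite -cs]; exact: c_homo.
Qed.

Lemma measurable_step_dilation (c : R -> int) (g : int -> R) (x : R) :
  {homo c : x y / x <= y >-> x <= y} ->
  measurable_fun setT (fun t : R => g (c (t * x))).
Proof.
move=> c_homo; have mx : measurable_fun setT (fun t : R => t * x).
  exact: mulrr_measurable.
exact: (measurableT_comp (measurable_step g c_homo) mx).
Qed.

Lemma lattice_negligible (x : R) (P : R -> Prop) : 0 < x ->
  (forall t, t * x \isn't a Num.int -> P t) ->
  {ae @lebesgue_measure R, forall t, P t}.
Proof.
move=> x0 HP; pose N := \bigcup_(z : int) [set (z%:~R / x : R)].
exists N; split.
- by apply: countable_bigcupT_measurable => // z; exact: measurable_set1.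
- apply: countable_lebesgue_measure0; rewrite /N.
  apply: bigcup_countable => // z _; exact: countable1.
- move=> t /= nP; have /intrP[z tz] : t * x \is a Num.int.
    by apply: contrapT => /negP /HP.
  by exists z => //=; rewrite -tz mulfK// gt_eqF.
Qed.

Lemma lint_sum (I : Type) (r : seq I) (f : I -> R -> R) :
  (forall i, measurable_fun setT (f i)) -> (forall i t, 0 <= f i t) ->
  lint (fun t => \sum_(i <- r) f i t) = (\sum_(i <- r) lint (f i))%E.
Proof.
move=> mf f0; rewrite /lint.
under eq_integral do rewrite -sumEFin.
rewrite ge0_integral_sum//.
- by move=> i; exact: (measurableT_comp _ (mf i)).
- by move=> i t _; rewrite lee_fin.
Qed.

Lemma ceil_absz_eq (y : R) (j : nat) : 0 < y ->
  (j.-1%:R < y) && (y <= j%:R) = (j == `|Num.ceil y|%N).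
Proof.
move=> y0; have := ceil_itv y; have := ceil_gt0 y; rewrite y0.
case: (Num.ceil y) => // c /= c0; rewrite intrB => /andP[].
rewrite -[c%:~R]/(c%:R) -[1%:~R]/1 => cy yc.
have c_gt0 : (0 < c)%N by [].
apply/idP/eqP => [/andP[jy yj]|->]; last first.
  rewrite yc andbT (le_lt_trans _ cy)//.
  by rewrite -[in leRHS](prednK c_gt0) -natr1 addrK.
have jc : (j.-1 < c)%N by rewrite -(ltr_nat R); exact: lt_le_trans yc.
have cj : (c < j.+1)%N.
  rewrite -(ltr_nat R) -natr1 -ltrBlDr; exact: lt_le_trans yj.
have j0 : (0 < j)%N by rewrite -(ltr_nat R); exact: lt_le_trans yj.
apply/eqP; rewrite eqn_leq -[(c <= j)%N]ltnS cj andbT.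
by rewrite -(prednK j0).
Qed.

Section Sequence.
Variables (p : R -> R) (pn : nat -> nat -> R) (a : nat -> R) (k : nat) (M : R).
Hypothesis qd : log_density (cut01 p).
Hypothesis pn_pmf : forall n : nat, (1 <= n)%N -> pmf_on n (pn n).
Hypothesis k_ge1 : (1 <= k)%N.
Hypothesis a_bounded : forall n, 0 <= a n <= M.
Hypothesis a_rec : forall n : nat, (k <= n)%N ->
  a n.+1 = \sum_(1 <= j < n.+1) pn n j * a j.

(** Reading index [j] on the cell [j - 1, j[ makes the recurrence an exact
    averaging identity on every interval [n, n + 1[ with [k <= n]. *)
Definition interpolation (x : R) : R := a (`|Num.floor x|%N).+1.

Let A := interpolation.

Let mp : measurable_fun setT (cut01 p) := log_density_measurable qd.

Lemma measurable_interpolation : measurable_fun setT A.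
Proof.
exact: (measurable_step (fun z : int => a (`|z|%N).+1) (@le_floor R)).
Qed.

Lemma measurable_step_density x :
  measurable_fun setT (fun t : R => step_density pn x t).
Proof.
apply: measurable_funM => //.
exact: (measurable_step_dilation (fun z : int => pn `|Num.floor x|%N `|z|%N) x
  (@le_ceil R)).
Qed.

Lemma floor_absz_bounds (x : R) : 0 <= x ->
  (`|Num.floor x|%N)%:R <= x < (`|Num.floor x|%N).+1%:R.
Proof.
move=> x0; have := floor_itv x; have : 0 <= Num.floor x by rewrite floor_ge0.
by case: (Num.floor x) => // n _; rewrite intrD -natr1.
Qed.

(** Off the lattice of points [j / x], both [A (t * x)] and the step density at
    [t] are read off the same index, the ceiling of [t * x]; each of the cells
    has length [1 / x], which cancels the factor [x] of the density. *)
Lemma step_density_average x : 1 <= x -> k%:R <= x ->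
  lint (cut01 (fun t => A (t * x) * step_density pn x t)) = (A x)%:E.
Proof.
move=> x1 kx; have x0 : 0 < x by lra.
pose n := `|Num.floor x|%N.
have /andP[nx xn] := floor_absz_bounds (ltW x0); rewrite -/n in nx xn.
have kn : (k <= n)%N by rewrite -ltnS -(ltr_nat R); exact: le_lt_trans xn.
have n1 : (1 <= n)%N by exact: leq_trans kn.
have [pn0 pnout pn1] := pn_pmf n1.
have a0 j : 0 <= a j by case/andP: (a_bounded j).
have A0 y : 0 <= A y by exact: a0.
pose cell j t : R :=
  if (j.-1%:R / x < t) && (t <= j%:R / x) then 1 else 0.
have mcell j : measurable_fun setT (cell j).
  apply: measurable_guard => //; apply: measurable_and.
    exact: measurable_fun_ltr.
  exact: measurable_fun_ler.
have cell0 j t : 0 <= cell j t by rewrite /cell; case: ifP.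
have cellE j t : 0 < t -> cell j t = (j == `|Num.ceil (t * x)|%N)%:R.
  move=> t0; rewrite /cell ltr_pdivrMr// ler_pdivlMr// ceil_absz_eq ?mulr_gt0//.
  by case: eqP.
pose w j := x * pn n j * a j.
have w0 j : 0 <= w j by rewrite !mulr_ge0// ltW.
have mterm j : measurable_fun setT (fun t : R => w j * cell j t).
  exact: measurable_funM.
have term0 j t : 0 <= w j * cell j t by rewrite mulr_ge0.
transitivity (lint (fun t => \sum_(1 <= j < n.+1) w j * cell j t)).
  apply: ge0_ae_eq_integral => //.
  - apply/measurable_EFinP; apply: measurable_cut01; apply: measurable_funM.
      exact: (measurable_dilation x measurable_interpolation).
    exact: measurable_step_density.
  - apply/measurable_EFinP; exact: measurable_sum.
  - move=> t _; rewrite lee_fin /cut01; case: ifP => // _.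
    by rewrite mulr_ge0// /step_density mulr_ge0// ltW.
  - by move=> t _; rewrite lee_fin; apply: sumr_ge0 => j _.
  apply: (lattice_negligible x0) => t tx _; congr EFin; rewrite /cut01.
  have [t0|t0] := leP t 0.
    rewrite /= big_nat big1// => j /andP[j1 _].
    rewrite /cell ifF ?mulr0//; apply/negbTE; rewrite negb_and -leNgt.
    by rewrite (le_trans t0)// divr_ge0// ltW.
  have tx0 : 0 < t * x by rewrite mulr_gt0.
  have -> : \sum_(1 <= j < n.+1) w j * cell j t =
      if (1 <= `|Num.ceil (t * x)| < n.+1)%N then w `|Num.ceil (t * x)|%N else 0.
    transitivity (\sum_(1 <= j < n.+1 | j == `|Num.ceil (t * x)|%N) w j);
      last by rewrite big_nat1_eq.
    rewrite [RHS]big_mkcond/=; apply: eq_bigr => j _.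
    by rewrite cellE//; case: eqP => _; rewrite ?mulr1 ?mulr0.
  have ceil1 : (1 <= `|Num.ceil (t * x)|)%N.
    by rewrite absz_gt0 gt_eqF// ceil_gt0.
  rewrite ceil1/=; have [t1|t1] := ltP t 1.
    (* Off the lattice the ceiling exceeds the floor by exactly one. *)
    have -> : A (t * x) = a `|Num.ceil (t * x)|%N.
      rewrite /A /interpolation ceil_floor tx.
      have : 0 <= Num.floor (t * x) by rewrite floor_ge0 ltW.
      by case: (Num.floor _) => // m _; rewrite -PoszD addn1.
    rewrite /step_density -/n ltnS; case: ifPn => [_|nc].
      by rewrite /w mulrC.
    by rewrite pnout ?mulr0// ceil1.
  rewrite ifF//; apply/negbTE; rewrite -leqNgt.
  have nltx : n%:R < t * x.
    rewrite lt_neqAle (le_trans nx) ?ler_peMl ?(ltW x0)// andbT.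
    by apply: contraNneq tx => <-; rewrite rpred_nat.
  rewrite -(ltr_nat R) natr_absz ger0_norm; last by rewrite ltW// ceil_gt0.
  exact: lt_le_trans nltx (ceil_ge _).
rewrite lint_sum//.
rewrite (@eq_big_nat _ _ _ _ _ _ (fun j => (pn n j * a j)%:E)); last first.
  move=> [//|j] _; rewrite lintZ// lint_itv; last first.
    by rewrite ler_pM2r ?invr_gt0// ler_nat.
  rewrite -EFinM /= -natr1 /w; congr EFin; field; lra.
by rewrite sumEFin -a_rec.
Qed.

(** Replacing the step density by [p] in the exact identity costs at most [M]
    times their L1 distance. *)
Lemma interpolation_renewal_solution : strongly_discretizes pn p ->
  exists D kappa X0, renewal_solution (cut01 p) interpolation M D kappa X0.
Proof.
move=> [kappa [C [k0 C0 disc]]].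
have mA := measurable_interpolation.
have AM x : 0 <= A x <= M by exact: a_bounded.
have M0 : 0 <= M by case/andP: (a_bounded 0); exact: le_trans.
have q0 := log_density_ge0 qd.
exists (M * C), kappa, (Num.max C (Num.max 1 k%:R)); split=> //.
  by rewrite lt_max C0.
move=> x; rewrite !ge_max => /andP[Cx /andP[x1 kx]].
have x0 : 0 < x by lra.
have avg := step_density_average x1 kx.
have := disc x x1 Cx; rewrite integral01E.
set diff := cut01 _; set S := step_density pn x in diff *.
set Y := C * x `^ (- kappa) => diffE.
have [pn0 _ _] : pmf_on `|Num.floor x|%N (pn `|Num.floor x|%N).
  apply: pn_pmf; rewrite absz_gt0 gt_eqF//.
  by rewrite floor_gt0.
have S0 t : 0 <= S t by rewrite /S /step_density mulr_ge0// ltW.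
have mS : measurable_fun setT S by exact: measurable_step_density.
have mAx := measurable_dilation x mA.
have mAS : measurable_fun setT (cut01 (fun t => A (t * x) * S t)).
  by apply: measurable_cut01; exact: measurable_funM.
have AS0 t : 0 <= cut01 (fun t => A (t * x) * S t) t.
  by rewrite /cut01; case: ifP => // _; rewrite mulr_ge0//; case/andP: (AM (t * x)).
have mdiff : measurable_fun setT diff.
  have -> : diff = (fun t => `|cut01 S t - cut01 p t|).
    apply/funext => t; rewrite /diff /cut01; case: ifP => //.
    by rewrite subrr normr0.
  apply: (measurableT_comp (@normr_measurable R setT)).
  by apply: measurable_funB => //; exact: measurable_cut01.
have diff0 t : 0 <= diff t by rewrite /diff /cut01; case: ifP.
have mAq := measurable_mean_integrand qd x mA.
have Aq0 t : 0 <= A (t * x) * cut01 p t.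
  by rewrite mulr_ge0//; case/andP: (AM (t * x)).
have mMd : measurable_fun setT (fun t : R => M * diff t).
  exact: measurable_funM.
have Md0 t : 0 <= M * diff t by rewrite mulr_ge0.
have bound : (lint (fun t => M * diff t)%R <= (M * Y)%:E)%E.
  by rewrite lintZ// EFinM lee_wpmul2l ?lee_fin.
have swap t : `|cut01 (fun t => A (t * x) * S t) t - A (t * x) * cut01 p t|
    <= M * diff t.
  have /andP[A0 A1] := AM (t * x).
  rewrite /diff /cut01; case: ifP => _; last by rewrite !mulr0 subr0 normr0.
  by rewrite -mulrBr normrM ger0_norm// ler_wpM2r.
rewrite -mulrA -/Y ler_norml; apply/andP; split.
  rewrite -subr_ge0 opprK addrAC subr_ge0 -lee_fin EFinD -avg.
  rewrite (rmeanE qd x mA AM).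
  apply: le_trans (leeD2l _ bound); rewrite -lintD//.
  apply: le_lint => //; first exact: measurable_funD.
  move=> t; rewrite Aq0/=; have := swap t; rewrite ler_norml; lra.
rewrite lerBlDl -lee_fin EFinD -avg (rmeanE qd x mA AM).
apply: le_trans (leeD2l _ bound); rewrite -lintD//.
apply: le_lint => //; first exact: measurable_funD.
move=> t; rewrite AS0/=; have := swap t; rewrite ler_norml; lra.
Qed.

End Sequence.

End Discretization.

(** * Convergence of the sequence *)

Section ScalarRecurrence.
Context {R : realType}.
Variables (p : R -> R) (pn : nat -> nat -> R) (a : nat -> R) (k : nat).
Hypothesis p_density : continuous_density p.
Hypothesis p_log_moment : finite_log_moment p.
Hypothesis pn_pmf : forall n : nat, (1 <= n)%N -> pmf_on n (pn n).
Hypothesis pn_p : strongly_discretizes pn p.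
Hypothesis k_ge1 : (1 <= k)%N.
Hypothesis a_rec : forall n : nat, (k <= n)%N ->
  a n.+1 = \sum_(1 <= j < n.+1) pn n j * a j.

(** From time [k] on every term is a convex combination of earlier ones. *)
Lemma recurrence_bounded : exists B : R, forall n, `|a n| <= B.
Proof.
pose B := \sum_(0 <= i < k.+1) `|a i|; exists B.
have B0 : 0 <= B by exact: sumr_ge0.
elim/ltn_ind => -[|n] IH.
  by rewrite /B big_nat_recl// lerDl sumr_ge0.
have [kn|nk] := leqP k n.
  have [pn0 _ pn1] := pn_pmf (leq_trans k_ge1 kn).
  rewrite a_rec// (le_trans (ler_norm_sum _ _ _))//.
  rewrite -[leRHS]mul1r -pn1 mulr_suml !big_nat ler_sum// => j /andP[_ jn].
  by rewrite normrM ger0_norm// ler_wpM2l// IH.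
rewrite /B (bigD1_seq n.+1) ?iota_uniq ?mem_index_iota//=.
by rewrite lerDl sumr_ge0.
Qed.

Lemma recurrence_cvg : exists l : R, a n @[n --> \oo] --> l.
Proof.
have [B aB] := recurrence_bounded.
pose b n := a n + B.
have b_bounded n : 0 <= b n <= 2 * B.
  by have := aB n; rewrite ler_norml /b => /andP[? ?]; apply/andP; split; lra.
have b_rec n : (k <= n)%N -> b n.+1 = \sum_(1 <= j < n.+1) pn n j * b j.
  move=> kn; have [_ _ pn1] := pn_pmf (leq_trans k_ge1 kn).
  under eq_bigr do rewrite mulrDr.
  by rewrite big_split/= -a_rec// -mulr_suml pn1 mul1r.
have qd := log_density_cut01 p_density p_log_moment.
have [D [kappa [X0 bsol]]] := interpolation_renewal_solution qd
  pn_pmf k_ge1 b_bounded b_rec pn_p.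
have [l lP] := renewal_solution_cvg qd bsol.
(* At an integer [n] the interpolation is [b n.+1]. *)
exists (l - B); rewrite -cvg_shiftS; apply/cvgrPdist_le => eps eps0.
have [X XP] := lP eps eps0.
near=> n; have Xn : X <= n%:R by near: n; exact: nbhs_infty_ger.
have := XP _ Xn; rewrite /interpolation.
have -> : Num.floor (n%:R : R) = n%:Z by rewrite -[n%:R]/(n%:Z%:~R) intrKfloor.
rewrite distrC /b /=; congr (`|_| <= _); ring.
Unshelve. all: by end_near. Qed.

End ScalarRecurrence.

Lemma cvg_row_entries (R : realType) (d : nat) (a : nat -> 'rV[R]_d)
    (l : 'I_d -> R) : (forall i, a n ord0 i @[n --> \oo] --> l i) ->
  a n @[n --> \oo] --> \row_i l i.
Proof.
move=> al; apply/cvg_mx_entourageP => E entE.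
apply: filter_forall => i; apply: filter_forall => j.
have near_E : \forall n \near \oo, E (l j, a n ord0 j).
  by move: E entE; apply/cvg_app_entourageP; exact: al.
rewrite near_simpl/=; apply: filterS near_E => n En.
rewrite inE mxE (ord1 i); exact: En.
Qed.

Theorem theorem5 (R : realType) (p : R -> R) (pn : nat -> nat -> R)
    (d k : nat) (a : nat -> 'rV[R]_d)
    (p_density : continuous_density p)
    (p_log_moment : finite_log_moment p)
    (pn_pmf : forall n : nat, (1 <= n)%N -> pmf_on n (pn n))
    (pn_p : strongly_discretizes pn p)
    (d_ge1 : (1 <= d)%N) (k_ge1 : (1 <= k)%N)
    (a_rec : forall n : nat, (k <= n)%N ->
       a n.+1 = \sum_(1 <= j < n.+1) pn n j *: a j) :
  exists l : 'rV[R]_d, a n @[n --> \oo] --> l.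
Proof.
have entry i : exists l : R, a n ord0 i @[n --> \oo] --> l.
  apply: (recurrence_cvg p_density p_log_moment pn_pmf pn_p k_ge1) => n kn.
  by rewrite a_rec// summxE; apply: eq_bigr => j _; rewrite mxE.
have [l lP] := choice entry.
by exists (\row_i l i); exact: cvg_row_entries.
Qed.
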